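(* Fix an integer $d\geq 2$ and let $\mathcal{A}$ be the set of all vectors $a=(\alpha_1,\ldots,\alpha_d)$ with $\alpha_i>0$ and $2\sum_{i=1}^d\alpha_i=1$. For $a\in\mathcal{A}$ let $\mathbf{S}_t(a,d)$ be the symmetric random walk in $\mathbb{Z}^d$ defined by $\mathbf{S}_0=\mathbf{0}$, $\mathbf{S}_t=\mathbf{S}_{t-1}+\mathbf{e}_t$ ($t\geq1$), where the $\mathbf{e}_t$ are i.i.d., independent of the past, and $\mathsf{P}\{\mathbf{e}_t=\mathbf{1}_i\}=\mathsf{P}\{\mathbf{e}_t=-\mathbf{1}_i\}=\alpha_i$, $i=1,\ldots,d$. Then the family $\{\mathbf{S}_t(a,d): a\in\mathcal{A}\}$ is $(\mathcal{A},d)$-conservative, and it is characterized by the birth-and-death process with parameters $\lambda_n(2,d)$, $\mu_n(2,d)$: specifically, for every $a\in\mathcal{A}$ and every $n\geq1$, $$p^{(a,d)}(n)=\frac{\lambda_n(2,d)}{\lambda_n(2,d)+\mu_n(2,d)},$$ where for $\gamma>0$ and $n\geq1$ $$\mu_n(\gamma,d)=\sum_{i=1}^d i\gamma^{i}\binom{d}{i}\binom{n-1}{i-1},\qquad \lambda_n(\gamma,d)=\mu_n(\gamma,d)+\gamma\sum_{i=1}^{d-1}(d-i)\gamma^{i}\binom{d}{i}\binom{n-1}{i-1}.$$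
   Context: $\mathbf{1}_i$ denotes the $i$th unit vector of $\mathbb{Z}^d$ and $\|\mathbf{n}\|=\sum_{i=1}^d|n^{(i)}|$. For a random walk $\mathbf{S}_t$ the active time instants are $t_1=\inf\{t>0:\|\mathbf{S}_t\|>0\}$ and $t_j=\inf\{t>t_{j-1}:\|\mathbf{S}_t\|\neq\|\mathbf{S}_{t_{j-1}}\|\}$ for $j\geq2$. For a walk $\mathbf{S}_t(a,d)$ in a family indexed by a parameter set $\mathcal{A}$, set $P^{(a,d)}_{t_j}(n)=\mathsf{P}\{\|\mathbf{S}_{t_{j+1}}(a,d)\|=n+1\mid \|\mathbf{S}_{t_j}(a,d)\|=n\}$ and $p^{(a,d)}(n)=\lim_{j\to\infty}P^{(a,d)}_{t_j}(n)$. The family is called $(\mathcal{A},d)$-conservative if these limits exist and, for all $a_1,a_2\in\mathcal{A}$ and all $n\geq0$, $p^{(a_1,d)}(n)=p^{(a_2,d)}(n)$. *)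

(* Defs.v *)
From HB Require Import structures.
From mathcomp Require Import all_boot all_order all_algebra.
From mathcomp Require Import all_classical all_reals all_analysis.
Set Implicit Arguments. Unset Strict Implicit. Unset Printing Implicit Defensive.
Import Order.TTheory GRing.Theory Num.Theory.
Local Open Scope classical_set_scope.
Local Open Scope ring_scope.

Definition unitv (d : nat) (i : 'I_d) : 'I_d -> int :=
  fun k => ((k == i) : nat)%:Z.

Definition l1norm (d : nat) (v : 'I_d -> int) : nat :=
  (\sum_(i < d) `|v i|)%N.

Definition walk (d : nat) (T : Type) (e : nat -> T -> 'I_d -> int)
  (t : nat) (w : T) : 'I_d -> int :=
  fun i => \sum_(1 <= s < t.+1) e s w i.

(* active_at e j w k  <->  t_j(w) = k  (t_j finite).  With t_0 := 0, the
   recursion t_j = inf{t > t_{j-1} : ||S_t|| <> ||S_{t_{j-1}}||} also gives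
   t_1 = inf{t > 0 : ||S_t|| > 0} since S_0 = 0. *)
Fixpoint active_at (d : nat) (T : Type) (e : nat -> T -> 'I_d -> int)
  (j : nat) (w : T) (k : nat) : Prop :=
  match j with
  | 0 => k = 0%N
  | j'.+1 => exists k', active_at e j' w k' /\ (k' < k)%N /\
      l1norm (walk e k w) <> l1norm (walk e k' w) /\
      (forall m, (k' < m < k)%N -> l1norm (walk e m w) = l1norm (walk e k' w))
  end.

Definition norm_at_active (d : nat) (T : Type) (e : nat -> T -> 'I_d -> int)
  (j n : nat) : set T :=
  [set w | exists k, active_at e j w k /\ l1norm (walk e k w) = n].

Definition walk_model (R : realType) (d : nat) (dT : measure_display)
  (T : measurableType dT) (P : probability T R) (a : 'I_d -> R)
  (e : nat -> T -> 'I_d -> int) : Prop :=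
  [/\ (forall s (v : 'I_d -> int), measurable [set w | e s w = v]),
      (forall s (i : 'I_d), (0 < s)%N ->
          P [set w | e s w = unitv i] = (a i)%:E /\
          P [set w | e s w = (fun k => - unitv i k)] = (a i)%:E) &
      (forall (F : seq nat) (v : nat -> 'I_d -> int),
          uniq F -> all (fun s => 0 < s)%N F ->
          P [set w | forall s, s \in F -> e s w = v s] =
          (\prod_(s <- F) P [set w | e s w = v s])%E)].

Definition trans_prob (R : realType) (d : nat) (dT : measure_display)
  (T : measurableType dT) (P : probability T R)
  (e : nat -> T -> 'I_d -> int) (n j : nat) : R :=
  fine (P (norm_at_active e j.+1 n.+1 `&` norm_at_active e j n))
  / fine (P (norm_at_active e j n)).

(* lim_{j -> oo} of the conditional probabilities, taken along the (infinitely
   many) j for which the conditioning event has positive probability *)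
Definition cond_limit (R : realType) (dT : measure_display)
  (T : measurableType dT) (P : probability T R) (B : nat -> set T)
  (f : nat -> R) (l : R) : Prop :=
  (forall J, exists j, (J <= j)%N /\ (0 < P (B j))%E) /\
  (forall eps : R, 0 < eps -> exists J, forall j, (J <= j)%N ->
      (0 < P (B j))%E -> `|f j - l| < eps).

Definition mu_bd (R : realType) (n : nat) (g : R) (d : nat) : R :=
  \sum_(1 <= i < d.+1) i%:R * g ^+ i * 'C(d, i)%:R * 'C(n.-1, i.-1)%:R.

Definition lambda_bd (R : realType) (n : nat) (g : R) (d : nat) : R :=
  mu_bd n g d +
  g * \sum_(1 <= i < d) (d - i)%:R * g ^+ i * 'C(d, i)%:R * 'C(n.-1, i.-1)%:R.

(* Main.v *)
(** Every step changes the l1 norm by one, so almost surely the j-th active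
    time is j, and P(n) is the average over the sphere |x| = n, weighted by the
    law u_j of the walk, of the outward rate sum_i alpha_i (1 + [x_i = 0]).
    As j tends to infinity with j = n mod 2 this law becomes uniform on the
    sphere (strong ratio limit): by Cauchy-Schwarz, u_2k(x) <= u_2k(0) and
    k |-> u_2k(0) is log-convex; it is also at least (2k+1)^-d, which forces
    u_(2k+2)(0) / u_2k(0) -> 1; finally
    u_2k(0) - u_(2k+2m)(0) = sum_x u_2m(x) (u_2k(0) - u_2k(x)) with nonnegative
    terms gives u_2k(x) / u_2k(0) -> 1 for each even x, and one more step
    treats odd x.  The uniform average of the rate is (1 + q) / 2, where by
    symmetry q, the proportion of points of the sphere with x_i = 0, does not
    depend on i; counting the spheres of dimensions d and d - 1 with the
    generating function (1 + 2 (X + X^2 + ...))^d identifies it with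
    lambda_n / (lambda_n + mu_n). *)
Require Import Defs.
From HB Require Import structures.
From mathcomp Require Import all_boot all_order all_algebra.
From mathcomp Require Import all_classical all_reals all_analysis.
From mathcomp Require Import ring lra zify.
Import Order.TTheory GRing.Theory Num.Theory.
Import numFieldNormedType.Exports.
Local Open Scope classical_set_scope.
Local Open Scope ring_scope.
Set Implicit Arguments. Unset Strict Implicit. Unset Printing Implicit Defensive.

(** * Cauchy-Schwarz for finite sums and ratio limits of log-convex sequences *)

Lemma sum_CauchySchwarz (R : realFieldType) (J : Type) (s : seq J) (f g : J -> R) :
  (\sum_(i <- s) f i * g i) ^+ 2 <=
  (\sum_(i <- s) f i ^+ 2) * (\sum_(i <- s) g i ^+ 2).
Proof.
set X := \sum_(i <- s) f i ^+ 2; set Y := \sum_(i <- s) g i ^+ 2.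
set Z := \sum_(i <- s) f i * g i.
have quad u v : 0 <= u ^+ 2 * Y - 2 * (u * v) * Z + v ^+ 2 * X.
  rewrite [leRHS](_ : _ = \sum_(i <- s) (u * g i - v * f i) ^+ 2).
    by apply: sumr_ge0 => i _; exact: sqr_ge0.
  rewrite !mulr_sumr -sumrB -big_split /=; apply: eq_bigr => i _; ring.
have X0 : 0 <= X by apply: sumr_ge0 => i _; exact: sqr_ge0.
have [X1|X1] := eqVneq X 0; last first.
  have Xp : 0 < X by rewrite lt_neqAle eq_sym X1.
  have := quad X Z.
  rewrite [leRHS](_ : _ = X * (X * Y - Z ^+ 2)); last by ring.
  by rewrite pmulr_rge0// subr_ge0.
(* With [X = 0] the form is affine in [v]; unless [Z = 0], this [v] gives it the value -1. *)
have := quad 1 ((Y + 1) / (2 * Z)).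
have [->|Z0] := eqVneq Z 0; first by rewrite X1 expr0n mul0r.
rewrite X1 mulr0 addr0 expr1n mul1r mul1r.
rewrite (_ : 2 * ((Y + 1) / (2 * Z)) * Z = Y + 1); first by lra.
by field.
Qed.

Lemma polynomial_geometric_lt1 (R : archiRealFieldType) (d : nat) (r : R) :
  0 <= r -> r < 1 -> exists k : nat, ((2 * k).+1%:R ^+ d) * r ^+ k < 1.
Proof.
move=> r0 r1.
have [->|rN0] := eqVneq r 0.
  by exists 1%N; rewrite expr1 mulr0.
have rp : 0 < r by rewrite lt_neqAle eq_sym rN0.
pose h := r^-1 - 1.
have hp : 0 < h by rewrite subr_gt0 invf_gt1.
have rE : r = (1 + h)^-1 by rewrite /h addrC subrK invrK.
case: d => [|d]; first by exists 1%N; rewrite expr0 mul1r expr1.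
have bern m : 1 + m%:R * h <= (1 + h) ^+ m.
  elim: m => [|m IH]; first by rewrite mul0r addr0 expr0.
  rewrite exprS; apply: (@le_trans _ _ ((1 + h) * (1 + m%:R * h))); last first.
    by rewrite ler_pM2l //; lra.
  have m0 : 0 <= m%:R :> R by [].
  rewrite -natr1; nra.
(* With [k = 2 d m], [r ^ k] is the [d]-th power of [(r ^ m) ^ 2], so it is
   enough that the quadratic lower bound on [r ^ - 2 m] beats [4 d m + 1]. *)
pose c : R := (4 * d.+1)%:R / h ^+ 2.
have c0 : 0 <= c by rewrite divr_ge0// sqr_ge0.
have := archi_boundP c0; set m := Num.bound c => mc.
exists (m * 2 * d.+1)%N.
rewrite exprM -exprMn exprn_ilt1 //; first by rewrite mulr_ge0// exprn_ge0.
have h1 : 0 < 1 + h by lra.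
rewrite rE exprVn ltr_pdivrMr ?exprn_gt0// mul1r.
rewrite exprM.
apply: (@lt_le_trans _ _ ((1 + m%:R * h) ^+ 2)); last first.
  have mh : 0 <= 1 + m%:R * h by rewrite addr_ge0// mulr_ge0// ltW.
  by rewrite lerXn2r ?bern// nnegrE// exprn_ge0// ltW.
have : (4 * d.+1)%:R < m%:R * h ^+ 2 by rewrite -ltr_pdivrMr// exprn_gt0.
have mp : 0 < m%:R :> R by apply: le_lt_trans mc.
rewrite (_ : (2 * (m * 2 * d.+1)).+1 = (4 * d.+1) * m + 1)%N; last by lia.
move: (4 * d.+1)%N => D H; rewrite natrD natrM.
have H1 : D%:R * m%:R < m%:R ^+ 2 * h ^+ 2.
  by rewrite mulrC expr2 -mulrA ltr_pM2l.
have : 0 < m%:R * h by rewrite mulr_gt0.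
rewrite -exprMn in H1; nra.
Qed.

(** Log-convexity makes the ratios nondecreasing, and monotonicity of [A] bounds them by 1. If they
    stayed below [1 - eps], the geometric decay of [A] would violate its polynomial lower bound. *)
Lemma logconvex_ratio_cvg (R : realType) (d : nat) (A : nat -> R) :
  A 0%N <= 1 -> (forall k, 0 < A k) -> (forall k, A k.+1 <= A k) ->
  (forall k, A k.+1 ^+ 2 <= A k * A k.+2) ->
  (forall k, 1 <= (2 * k).+1%:R ^+ d * A k) ->
  (fun k => A k.+1 / A k) @ \oo --> (1 : R).
Proof.
move=> A01 A0 Adec Aconv Apoly.
pose r k := A k.+1 / A k.
have r1 k : r k <= 1 by rewrite ler_pdivrMr// mul1r.
have rS k : r k <= r k.+1.
  by rewrite /r ler_pdivrMr// mulrAC ler_pdivlMr// -expr2 mulrC.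
have rle : {homo r : m n / (m <= n)%N >-> m <= n}.
  exact: homo_leq (fun=> lexx _) le_trans rS.
apply/cvgrPdist_lt => eps eps0.
have [[K HK]|nK] := pselect (exists K, 1 - eps < r K).
  exists K => // k /= Kk.
  rewrite ger0_norm ?subr_ge0; first by have := rle _ _ Kk; rewrite -/(r k); lra.
  exact: r1.
have {}nK k : r k <= 1 - eps.
  by rewrite leNgt; apply/negP => H; apply: nK; exists k.
have q0 : 0 <= 1 - eps.
  by apply: le_trans (nK 0%N); rewrite divr_ge0// ltW.
have Ageo k : A k <= A 0%N * (1 - eps) ^+ k.
  elim: k => [|k IH]; first by rewrite expr0 mulr1.
  have := nK k; rewrite ler_pdivrMr// => H; apply: (le_trans H).
  by rewrite exprS mulrCA ler_wpM2l.
have [k Hk] := polynomial_geometric_lt1 d q0 ltac:(lra).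
have := Apoly k; rewrite leNgt => /negP; case.
apply: le_lt_trans Hk.
rewrite ler_wpM2l// ?exprn_ge0// (le_trans (Ageo k))// ler_piMl// exprn_ge0//.
Qed.

Lemma cvg_sum_real (R : realType) (J : eqType) (s : seq J) (f : J -> nat -> R) (l : J -> R) :
  (forall j, j \in s -> f j @ \oo --> l j) ->
  (fun k => \sum_(j <- s) f j k) @ \oo --> \sum_(j <- s) l j.
Proof.
elim: s => [|j s IH] fl.
  by rewrite big_nil; under eq_fun do rewrite big_nil; exact: cvg_cst.
rewrite big_cons; under eq_fun do rewrite big_cons.
apply: cvgD; first by apply: fl; rewrite mem_head.
by apply: IH => i si; apply: fl; rewrite in_cons si orbT.
Qed.

(** * Return probabilities of a symmetric walk on an abelian group *)

Section SymmetricWalk.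
Variables (R : realType) (V : zmodType) (I : finType) (a : I -> R) (h : I -> V).
Hypothesis a_gt0 : forall i, 0 < a i.
Hypothesis a_sum : 2 * \sum_i a i = 1.
Implicit Types (f g : V -> R) (x y z : V) (k m : nat).

(** The transition operator of the walk: [iter k avg f x] is the expectation of [f] after [k] steps
    from [x]. *)
Definition avg f x : R := \sum_i a i * (f (x + h i) + f (x - h i)).

Lemma iter_avgS k f x :
  iter k.+1 avg f x = \sum_i a i * (iter k avg f (x + h i) + iter k avg f (x - h i)).
Proof. by []. Qed.

Lemma eq_iter_avg k f g : f =1 g -> iter k avg f =1 iter k avg g.
Proof. by move=> /funext ->. Qed.

Lemma iter_avg_cst k (c : R) x : iter k avg (fun=> c) x = c.
Proof.
elim: k x => // k IH x; rewrite iter_avgS.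
under eq_bigr do rewrite !IH.
by rewrite -mulr_suml -mulr2n -mulr_natl mulrA [_ * 2]mulrC a_sum mul1r.
Qed.

Lemma iter_avg_sum (J : Type) (s : seq J) (c : J -> R) (F : J -> V -> R) k x :
  iter k avg (fun z => \sum_(j <- s) c j * F j z) x =
  \sum_(j <- s) c j * iter k avg (F j) x.
Proof.
elim: k x => // k IH x; rewrite iter_avgS.
under eq_bigr do rewrite !IH -big_split /= mulr_sumr.
rewrite exchange_big /=; apply: eq_bigr => j _.
by rewrite mulr_sumr; apply: eq_bigr => i _; ring.
Qed.

Lemma iter_avgB k f g x :
  iter k avg (fun z => f z - g z) x = iter k avg f x - iter k avg g x.
Proof.
elim: k x => // k IH x; rewrite !iter_avgS -sumrB.
by apply: eq_bigr => i _; rewrite !IH; ring.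
Qed.

Lemma iter_avg_ge0 k f x : (forall z, 0 <= f z) -> 0 <= iter k avg f x.
Proof.
move=> f0; elim: k x => // k IH x; rewrite iter_avgS.
by apply: sumr_ge0 => i _; rewrite mulr_ge0 ?addr_ge0// ltW.
Qed.

Lemma le_iter_avg k f g x :
  (forall z, f z <= g z) -> iter k avg f x <= iter k avg g x.
Proof.
move=> fg; rewrite -subr_ge0 -iter_avgB; apply: iter_avg_ge0 => z.
by rewrite subr_ge0.
Qed.

Lemma iter_avg_shift k f v x : iter k avg (fun z => f (v + z)) x = iter k avg f (v + x).
Proof.
elim: k x => // k IH x; rewrite !iter_avgS.
by apply: eq_bigr => i _; rewrite !IH !addrA.
Qed.

Lemma iter_avg_opp k f x : iter k avg (fun z => f (- z)) x = iter k avg f (- x).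
Proof.
elim: k x => // k IH x; rewrite !iter_avgS.
by apply: eq_bigr => i _; rewrite !IH opprD opprB addrC [h i - x]addrC.
Qed.

(** The law [u_k] of the walk started at 0, not a first-passage probability. *)
Definition hit k x : R := iter k avg (fun z => (z == x)%:R) 0.

Lemma hit_ge0 k x : 0 <= hit k x.
Proof. by apply: iter_avg_ge0. Qed.

Lemma iter_avg_delta k x y : iter k avg (fun z => (z == x)%:R) y = hit k (x - y).
Proof.
rewrite /hit -{1}(addr0 y) -iter_avg_shift; apply: eq_iter_avg => z.
by rewrite [in RHS]eq_sym subr_eq eq_sym addrC.
Qed.

Lemma hitN k x : hit k (- x) = hit k x.
Proof.
rewrite /hit -[in RHS]oppr0 -iter_avg_opp; apply: eq_iter_avg => z.
by rewrite eqr_oppLR.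
Qed.

(** Chapman-Kolmogorov; translation invariance turns [k] steps from [z] to [x] into [k] steps from 0
    to [x - z]. *)
Lemma hitD m k x : hit (m + k) x = iter m avg (fun z => hit k (x - z)) 0.
Proof.
by rewrite /hit iterD; apply: eq_iter_avg => z; rewrite iter_avg_delta.
Qed.

Lemma iter_avg_supp k (s : seq V) f : uniq s -> (forall z, z \notin s -> f z = 0) ->
  iter k avg f 0 = \sum_(y <- s) f y * hit k y.
Proof.
move=> us fs; rewrite -iter_avg_sum; apply: eq_iter_avg => z.
have [zs|zs] := boolP (z \in s).
  rewrite (bigD1_seq z)//= eqxx mulr1 big1 ?addr0// => i /negbTE.
  by rewrite eq_sym => ->; rewrite mulr0.
rewrite fs// big_seq big1// => i si; case: eqP => [zi|]; last by rewrite mulr0.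
by rewrite zi si in zs.
Qed.

Lemma iter_avg_sum_le k (s : seq V) f : uniq s -> (forall z, 0 <= f z) ->
  \sum_(y <- s) f y * hit k y <= iter k avg f 0.
Proof.
move=> us f0.
rewrite (eq_big_seq (fun y => (f y * (y \in s)%:R) * hit k y)); last first.
  by move=> y ->; rewrite mulr1.
rewrite -(@iter_avg_supp k s (fun y => f y * (y \in s)%:R))//; last first.
  by move=> z /negbTE ->; rewrite mulr0.
by apply: le_iter_avg => z; rewrite ler_piMr// lern1 leq_b1.
Qed.

(* [ball k] contains all positions reachable in [k] steps, and has
   polynomially many elements. *)
Variables (d : nat) (ball : nat -> seq V).
Hypothesis ball_uniq : forall k, uniq (ball k).
Hypothesis ball0 : 0 \in ball 0.
Hypothesis ballS : forall k i x,
  x \in ball k -> (x + h i \in ball k.+1) && (x - h i \in ball k.+1).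
Hypothesis ball_size : forall k, (size (ball k) <= (2 * k).+1 ^ d)%N.

Lemma iter_avg_ball k f : (forall z, z \in ball k -> f z = 0) -> iter k avg f 0 = 0.
Proof.
(* Generalized to a start in [ball m] with [j] steps left, since the induction moves the start. *)
move=> f0; suff H j m x : (j + m)%N = k -> x \in ball m -> iter j avg f x = 0.
  by apply: (H k 0%N); rewrite ?addn0.
elim: j m x => [|j IH] m x jm xm; first by apply: f0; rewrite -jm add0n.
rewrite iter_avgS big1// => i _; have /andP[x1 x2] := ballS i xm.
by rewrite !(IH m.+1) ?addr0 ?mulr0 ?addnS -?addSn.
Qed.

Lemma hit_ball k x : x \notin ball k -> hit k x = 0.
Proof.
by move=> xk; apply: iter_avg_ball => z zk; case: eqP => // zx; rewrite -zx zk in xk.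
Qed.

Lemma sum_hit k : \sum_(y <- ball k) hit k y = 1.
Proof.
have -> : \sum_(y <- ball k) hit k y =
    iter k avg (fun z => (z \in ball k)%:R) 0.
  rewrite (iter_avg_supp _ (ball_uniq k)); last by move=> z /negbTE ->.
  by apply: eq_big_seq => y ->; rewrite mul1r.
apply/eqP; rewrite eq_sym -subr_eq0 -{1}(iter_avg_cst k 1 0) -iter_avgB.
by apply/eqP/iter_avg_ball => z ->; rewrite subrr.
Qed.

(** Symmetry of the law turns the convolution at 0 into a sum of squares. *)
Lemma hit_double0 k : hit (k + k) 0 = \sum_(y <- ball k) hit k y ^+ 2.
Proof.
rewrite hitD (iter_avg_supp _ (ball_uniq k)).
  by apply: eq_bigr => y _; rewrite sub0r hitN.
by move=> z zk; rewrite sub0r hitN hit_ball.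
Qed.

Lemma sum_sqr_hit_le k (s : seq V) : uniq s ->
  \sum_(y <- s) hit k y ^+ 2 <= hit (k + k) 0.
Proof.
move=> us; rewrite hitD.
have -> : iter k avg (fun z => hit k (0 - z)) 0 = iter k avg (hit k) 0.
  by apply: eq_iter_avg => z; rewrite sub0r hitN.
apply: le_trans (iter_avg_sum_le k us (hit_ge0 k)).
by apply: ler_sum => i _; rewrite expr2.
Qed.

(** Chapman-Kolmogorov at half time and [2 u v <= u ^ 2 + v ^ 2]: each sum of squares is at most the
    return probability. *)
Lemma hit_double_le k x : hit (k + k) x <= hit (k + k) 0.
Proof.
(* The reflected ball contains the support of [z |-> hit k (x - z)], and reindexing makes the first
   sum of squares the return probability itself. *)
pose s := [seq x - z | z <- ball k].
have us : uniq s.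
  by rewrite map_inj_uniq// => y z /addrI/oppr_inj.
rewrite hitD (iter_avg_supp _ us); last first.
  move=> z zs; apply: hit_ball; apply: contra zs => zs.
  by apply/mapP; exists (x - z) => //; rewrite subKr.
have ps : \sum_(y <- s) hit k (x - y) ^+ 2 = hit (k + k) 0.
  by rewrite big_map hit_double0; apply: eq_bigr => z _; rewrite subKr.
apply: (@le_trans _ _ (\sum_(y <- s) (hit k (x - y) ^+ 2 + hit k y ^+ 2) / 2)).
  apply: ler_sum => y _; have := sqr_ge0 (hit k (x - y) - hit k y); nra.
rewrite -mulr_suml big_split /= ps.
have := sum_sqr_hit_le k us; lra.
Qed.

(** Cauchy-Schwarz against the constant 1, for a unit mass carried by at most [(2 * k).+1 ^ d]
    points. *)
Lemma hit_return_lower_bound k : 1 <= (2 * k).+1%:R ^+ d * hit (k + k) 0.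
Proof.
have := sum_CauchySchwarz (ball k) (fun=> 1) (hit k).
rewrite -hit_double0; under eq_bigr do rewrite mul1r.
rewrite sum_hit expr1n.
rewrite big_const_seq count_predT iter_addr_0 => H; apply: (le_trans H).
by rewrite ler_wpM2r ?hit_ge0// -natrX ler_nat.
Qed.

Lemma hit_return_gt0 k : 0 < hit (k + k) 0.
Proof.
by have := lt_le_trans ltr01 (hit_return_lower_bound k); rewrite pmulr_rgt0// exprn_gt0.
Qed.

(** The time [2 k + 2] is split unevenly as [(k + 2) + k]; Cauchy-Schwarz then produces the return
    probabilities at times [2 k] and [2 k + 4]. *)
Lemma hit_return_logconvex k :
  hit (k.+1 + k.+1) 0 ^+ 2 <= hit (k + k) 0 * hit (k.+2 + k.+2) 0.
Proof.
have -> : hit (k.+1 + k.+1) 0 = \sum_(y <- ball k) hit k y * hit k.+2 y.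
  rewrite (_ : (k.+1 + k.+1 = k.+2 + k)%N); last by lia.
  rewrite hitD (iter_avg_supp _ (ball_uniq k)).
    by apply: eq_bigr => y _; rewrite sub0r hitN.
  by move=> z zk; rewrite sub0r hitN hit_ball.
apply: le_trans (sum_CauchySchwarz _ _ _) _.
rewrite -hit_double0 ler_wpM2l ?hit_ge0//.
exact: sum_sqr_hit_le.
Qed.

(* Averaging the nonnegative function [hit (k + k) 0 - hit (k + k) z] over
   the position [z] of the walk at time [m + m] and keeping only [z = x]. *)
Lemma hit_defect_le k m x :
  (hit (k + k) 0 - hit (k + k) x) * hit (m + m) x <=
  hit (k + k) 0 - hit ((m + k) + (m + k)) 0.
Proof.
have -> : hit ((m + k) + (m + k)) 0 =
    iter (m + m) avg (fun z => hit (k + k) z) 0.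
  rewrite (_ : ((m + k) + (m + k) = (m + m) + (k + k))%N); last by lia.
  by rewrite hitD; apply: eq_iter_avg => z; rewrite sub0r hitN.
rewrite -{2}(iter_avg_cst (m + m) (hit (k + k) 0) 0) -iter_avgB.
have := @iter_avg_sum_le (m + m) [:: x]
  (fun z => hit (k + k) 0 - hit (k + k) z) isT.
by rewrite big_seq1; apply => z; rewrite subr_ge0 hit_double_le.
Qed.

(** The ratio telescopes into shifted copies of the case [m = 1], which [logconvex_ratio_cvg]
    settles. *)
Lemma hit_return_ratio_cvg m :
  (fun k => hit ((m + k) + (m + k)) 0 / hit (k + k) 0) @ \oo --> (1 : R).
Proof.
have r1 : (fun k => hit (k.+1 + k.+1) 0 / hit (k + k) 0) @ \oo --> (1 : R).
  apply: (@logconvex_ratio_cvg R d (fun k => hit (k + k) 0)).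
  - by rewrite /hit /= eqxx.
  - exact: hit_return_gt0.
  - move=> k; rewrite -subr_ge0; apply: le_trans (hit_defect_le k 1 0).
    by rewrite subrr mul0r.
  - exact: hit_return_logconvex.
  - exact: hit_return_lower_bound.
elim: m => [|m IH].
  apply: cvg_near_cst; near=> k.
  by rewrite !add0n divff// gt_eqF// hit_return_gt0.
have r2 : (fun k => hit ((m + k).+1 + (m + k).+1) 0 / hit ((m + k) + (m + k)) 0) @ \oo
    --> (1 : R).
  under eq_fun do rewrite [(m + _)%N]addnC.
  have E := cvg_shiftn m (fun k => hit (k.+1 + k.+1) 0 / hit (k + k) 0 : R) (nbhs (1 : R)).
  by move: r1; rewrite -E.
have -> : (fun k => hit ((m.+1 + k) + (m.+1 + k)) 0 / hit (k + k) 0) =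
    (fun k => hit ((m + k).+1 + (m + k).+1) 0 / hit ((m + k) + (m + k)) 0) \*
    (fun k => hit ((m + k) + (m + k)) 0 / hit (k + k) 0).
  by apply/funext => k /=; rewrite mulrA divfK// gt_eqF// hit_return_gt0.
by rewrite -[X in _ --> X](mulr1 1); exact: (cvgM r2 IH).
Unshelve. all: by end_near.
Qed.

(** Dividing [hit_defect_le] by the fixed positive number [hit (m + m) x] and by the return
    probability squeezes the ratio up to 1. *)
Lemma hit_even_ratio_cvg m x : 0 < hit (m + m) x ->
  (fun k => hit (k + k) x / hit (k + k) 0) @ \oo --> (1 : R).
Proof.
move=> hx.
apply: (@squeeze_cvgr _ _ _ _
  (fun k => 1 - (1 - hit ((m + k) + (m + k)) 0 / hit (k + k) 0) / hit (m + m) x)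
  (fun=> 1)); last 2 first.
- rewrite [X in _ --> X](_ : _ = 1 - (1 - 1) / hit (m + m) x :> R); last by ring.
  apply: cvgB; first exact: cvg_cst.
  apply: cvgMr_tmp; apply: cvgB; first exact: cvg_cst.
  exact: hit_return_ratio_cvg.
- exact: cvg_cst.
near=> k; have A0 := hit_return_gt0 k; apply/andP; split.
  rewrite lerBlDl -lerBlDr ler_pdivlMr//.
  have /divff AA : hit (k + k) 0 != 0 by rewrite gt_eqF.
  by rewrite -AA -!mulrBl mulrAC ler_pM2r ?invr_gt0// hit_defect_le.
by rewrite ler_pdivrMr// mul1r hit_double_le.
Unshelve. all: by end_near.
Qed.

(** Conditioning on one step leaves the neighbours [x + h i] and [x - h i], where the even case
    applies; their weights add up to one. *)
Lemma hit_odd_ratio_cvg x :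
  (forall i, exists m, 0 < hit (m + m) (x + h i)) ->
  (forall i, exists m, 0 < hit (m + m) (x - h i)) ->
  (fun k => hit (k + k).+1 x / hit (k + k) 0) @ \oo --> (1 : R).
Proof.
move=> xp xm.
have -> : (fun k => hit (k + k).+1 x / hit (k + k) 0) =
  (fun k => \sum_i a i * (hit (k + k) (x + h i) / hit (k + k) 0 +
                           hit (k + k) (x - h i) / hit (k + k) 0)).
  apply/funext => k; rewrite -add1n hitD /= /avg mulr_suml.
  apply: eq_bigr => i _; rewrite -mulrA mulrDl; congr (_ * _).
  by rewrite !add0r opprK addrC.
rewrite -[X in _ --> X]a_sum mulr_sumr.
apply: cvg_sum_real => i _; rewrite mulrC; apply: cvgMl_tmp.
rewrite (_ : 2 = 1 + 1) //; apply: cvgD.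
  by have [m /hit_even_ratio_cvg] := xp i.
by have [m /hit_even_ratio_cvg] := xm i.
Qed.

End SymmetricWalk.

(** * The walk on the integer lattice *)

Section Lattice.
Variable d : nat.
Local Notation V := {ffun 'I_d -> int}.
Implicit Types (x y z : V) (i : 'I_d).

Definition step i : V := [ffun k => unitv i k].

Lemma l1normD1 x i : l1norm x = (`|x i| + \sum_(j < d | j != i) `|x j|)%N.
Proof. by rewrite /l1norm (bigD1 i). Qed.

Lemma l1norm_stepD x i :
  l1norm (x + step i) = (`|(x i + 1)%R| + \sum_(j < d | j != i) `|x j|)%N.
Proof.
rewrite (l1normD1 _ i) !ffunE /unitv eqxx; congr addn.
by apply: eq_bigr => j /negbTE ji; rewrite !ffunE /unitv ji addr0.
Qed.

Lemma l1norm_stepB x i :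
  l1norm (x - step i) = (`|(x i - 1)%R| + \sum_(j < d | j != i) `|x j|)%N.
Proof.
rewrite (l1normD1 _ i) !ffunE /unitv eqxx; congr addn.
by apply: eq_bigr => j /negbTE ji; rewrite !ffunE /unitv ji subr0.
Qed.

Lemma l1norm_stepD_up x i : (l1norm (x + step i) == (l1norm x).+1) = (0 <= x i).
Proof. by rewrite l1norm_stepD (l1normD1 x i); lia. Qed.

Lemma l1norm_stepB_up x i : (l1norm (x - step i) == (l1norm x).+1) = (x i <= 0).
Proof. by rewrite l1norm_stepB (l1normD1 x i); lia. Qed.

Lemma odd_l1norm_stepD x i : odd (l1norm (x + step i)) = ~~ odd (l1norm x).
Proof. by rewrite l1norm_stepD (l1normD1 x i); lia. Qed.

Lemma odd_l1norm_stepB x i : odd (l1norm (x - step i)) = ~~ odd (l1norm x).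
Proof. by rewrite l1norm_stepB (l1normD1 x i); lia. Qed.

Lemma l1norm0 : l1norm (0 : V) = 0%N.
Proof. by rewrite /l1norm big1// => i _; rewrite ffunE. Qed.

Lemma l1norm_eq0 x : l1norm x = 0%N -> x = 0.
Proof.
move=> /eqP; rewrite sum_nat_eq0 => /forallP x0; apply/ffunP => i.
by have /= := x0 i; rewrite absz_eq0 ffunE => /eqP.
Qed.

Lemma le_l1norm x i : (`|x i| <= l1norm x)%N.
Proof. by rewrite (l1normD1 _ i) leq_addr. Qed.

(** The sup-norm ball of radius [k]. The [2 k + 1] values of a coordinate are indexed by [k + k.+1],
    so that negative values can be split off in [sum_powX_dist]. *)
Definition box (k : nat) : seq V :=
  [seq [ffun i => (f i : nat)%:Z - k%:Z] | f : {ffun 'I_d -> 'I_(k + k.+1)}].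

Lemma mem_box k x : (x \in box k) = [forall i, (`|x i| <= k)%N].
Proof.
apply/mapP/forallP => [[f _ ->] i|H].
  rewrite ffunE; move: (ltn_ord (f i)); move: (nat_of_ord (f i)) => m; lia.
have lt i : (`|(x i + k%:Z)%R| < k + k.+1)%N by have := H i; lia.
exists [ffun i => Ordinal (lt i)]; first by rewrite mem_enum.
by apply/ffunP => i; rewrite !ffunE /=; have := H i; lia.
Qed.

Lemma box_uniq k : uniq (box k).
Proof.
rewrite map_inj_uniq ?enum_uniq// => f g /ffunP fg; apply/ffunP => i.
by have := fg i; rewrite !ffunE => ?; apply: val_inj => /=; lia.
Qed.

Lemma box0 : 0 \in box 0.
Proof. by rewrite mem_box; apply/forallP => i; rewrite ffunE. Qed.

Lemma boxS k i x :
  x \in box k -> (x + step i \in box k.+1) && (x - step i \in box k.+1).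
Proof.
rewrite !mem_box => /forallP xk; apply/andP.
by split; apply/forallP => j; have := xk j; rewrite !ffunE /unitv;
  case: (j == i) => /=; lia.
Qed.

Lemma size_box k : (size (box k) <= (2 * k).+1 ^ d)%N.
Proof.
rewrite size_map -cardT card_ffun !card_ord.
by rewrite (_ : (k + k.+1 = (2 * k).+1)%N)//; lia.
Qed.

Definition sphere n : seq V := [seq x : V <- box n | l1norm x == n].

Lemma mem_sphere n x : (x \in sphere n) = (l1norm x == n).
Proof.
rewrite mem_filter andb_idr// => /eqP <-; rewrite mem_box.
by apply/forallP => i; exact: le_l1norm.
Qed.

Lemma sphere_uniq n : uniq (sphere n).
Proof. exact/filter_uniq/box_uniq. Qed.

Lemma exists_norm n (i : 'I_d) : exists x, l1norm x = n.
Proof.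
exists [ffun j => if j == i then n%:Z else 0].
rewrite (l1normD1 _ i) ffunE eqxx big1 ?addn0// => j /negbTE ji.
by rewrite ffunE ji.
Qed.

End Lattice.

(** * Ratio limits on the lattice and averages over spheres *)

Section LatticeWalk.
Variables (R : realType) (d : nat) (a : 'I_d -> R).
Hypothesis a_gt0 : forall i, 0 < a i.
Hypothesis a_sum : 2 * \sum_i a i = 1.
Local Notation V := {ffun 'I_d -> int}.
Local Notation Avg := (avg a (@step d)).
Local Notation Hit := (hit a (@step d)).
Implicit Types (x y z : V).

(** Each step flips the parity of the norm. *)
Lemma iter_avg_parity k (f : V -> R) x :
  (forall z, odd (l1norm z) = odd (l1norm x + k) -> f z = 0) ->
  iter k Avg f x = 0.
Proof.
elim: k x => [|k IH] x f0; first by apply: f0; rewrite addn0.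
rewrite iter_avgS big1// => i _; rewrite !IH ?addr0 ?mulr0// => z.
  by rewrite oddD odd_l1norm_stepB => zx; apply: f0; rewrite zx addnS oddS oddD addNb.
by rewrite oddD odd_l1norm_stepD => zx; apply: f0; rewrite zx addnS oddS oddD addNb.
Qed.

(** Moving a nonzero coordinate toward 0 lowers the norm by one, and such a step has positive
    probability. *)
Lemma hit_norm_gt0 x : 0 < Hit (l1norm x) x.
Proof.
move: {2}(l1norm x) (erefl (l1norm x)) => n; rewrite [in _ < _]/=.
elim: n x => [|n IH] x xn.
  by rewrite xn (l1norm_eq0 xn) /hit /= eqxx.
have [i xi] : exists i, x i != 0.
  apply/existsP; rewrite -negb_forall; apply/negP => /forallP x0.
  by move: xn; rewrite /l1norm big1// => i _; rewrite (eqP (x0 i)).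
rewrite xn -add1n hitD /= /avg (bigD1 i)//= ltr_pwDl//; last first.
  by apply: sumr_ge0 => j _; rewrite mulr_ge0 ?addr_ge0 ?hit_ge0// ltW.
rewrite pmulr_rgt0// add0r.
have [xi0|xi0] := ltP 0 (x i).
  have ny : l1norm (x - step i) = n.
    by have := xn; rewrite l1norm_stepB (l1normD1 x i); lia.
  by rewrite ltr_pwDl ?hit_ge0//; have := IH _ ny; rewrite ny.
have ny : l1norm (x + step i) = n.
  by have := xn; rewrite l1norm_stepD (l1normD1 x i); lia.
by rewrite addrC ltr_pwDl ?hit_ge0//; have := IH _ ny; rewrite sub0r opprK ny.
Qed.

Lemma hit_even_norm_gt0 x : ~~ odd (l1norm x) -> exists m, 0 < Hit (m + m) x.
Proof.
move=> ox; exists (l1norm x)./2; have := hit_norm_gt0 x.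
by rewrite -{1}(odd_double_half (l1norm x)) (negbTE ox) add0n addnn.
Qed.

(** The offset [odd (l1norm x)] selects the times of the right parity; the neighbours of an odd
    point are even. *)
Lemma hit_ratio_cvg x :
  (fun k => Hit (odd (l1norm x) + (k + k)) x / Hit (k + k) 0) @ \oo --> (1 : R).
Proof.
have [ox|ox] := boolP (odd (l1norm x)).
  apply: (@hit_odd_ratio_cvg _ _ _ _ _ a_gt0 a_sum d (@box d)).
  - exact: box_uniq.
  - exact: box0.
  - by move=> k i y; exact: boxS.
  - exact: size_box.
  - by move=> i; apply: hit_even_norm_gt0; rewrite odd_l1norm_stepD ox.
  - by move=> i; apply: hit_even_norm_gt0; rewrite odd_l1norm_stepB ox.
have [m] := hit_even_norm_gt0 ox.
apply: (@hit_even_ratio_cvg _ _ _ _ _ a_gt0 a_sum d (@box d)).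
- exact: box_uniq.
- exact: box0.
- by move=> k i y; exact: boxS.
- exact: size_box.
Qed.

(** The probability that a step from [x] increases the norm: in direction [i] one sign does so if
    [x i] is nonzero, both if it is 0. *)
Definition up_rate x : R := \sum_i a i * (1 + (x i == 0)%:R).

Lemma avg_norm_succ x :
  Avg (fun z => (l1norm z == (l1norm x).+1)%:R) x = up_rate x.
Proof.
apply: eq_bigr => i _; congr (_ * _).
rewrite l1norm_stepD_up l1norm_stepB_up.
by case: (ltgtP (x i) 0); rewrite ?addr0 ?add0r.
Qed.

(** Rescaled by the return probability, the law tends to 1 at each point of the sphere, so the limit
    is a sum against counting measure. *)
Lemma iter_avg_sphere_cvg n (g : V -> R) :
  (fun k => iter (odd n + (k + k)) Avg (fun z => (l1norm z == n)%:R * g z) 0 /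
            Hit (k + k) 0) @ \oo --> \sum_(x <- sphere d n) g x.
Proof.
have -> : (fun k => iter (odd n + (k + k)) Avg (fun z => (l1norm z == n)%:R * g z) 0 /
                    Hit (k + k) 0) =
    (fun k => \sum_(x <- sphere d n) g x * (Hit (odd n + (k + k)) x / Hit (k + k) 0)).
  apply/funext => k; rewrite (iter_avg_supp _ _ _ (sphere_uniq d n)); last first.
    by move=> z; rewrite mem_sphere => /negbTE ->; rewrite mul0r.
  rewrite mulr_suml; apply: eq_big_seq => x.
  by rewrite mem_sphere => ->; rewrite mul1r mulrA.
apply: cvg_sum_real => x; rewrite mem_sphere => /eqP <-.
by rewrite -[X in _ --> X]mulr1; apply: cvgMl_tmp; exact: hit_ratio_cvg.
Qed.

End LatticeWalk.

(** * Counting the sphere *)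

Section SphereCount.
Variables (R : realType).

Lemma sum_powX_mulBX (N : nat) :
  (1 - 'X) * \sum_(m < N) 'X^(m.+1) = 'X - 'X^(N.+1) :> {poly R}.
Proof.
elim: N => [|N IH]; first by rewrite big_ord0 mulr0 expr1 subrr.
by rewrite big_ord_recr /= mulrDr IH mulrBl mul1r -exprS addrA subrK.
Qed.

(* Compositions of [n + 1] into [i + 1] positive parts: multiplying the
   generating function by [1 - X] gives Pascal's rule. *)
Lemma coef_exp_sum_powX (N i n : nat) : (n < N)%N ->
  ((\sum_(m < N) 'X^(m.+1) : {poly R}) ^+ i.+1)`_n.+1 = 'C(n, i)%:R.
Proof.
set T := \sum_(m < N) _ => nN.
have rec j m : (m < N)%N -> (T ^+ j.+1)`_m.+1 = (T ^+ j.+1)`_m + (T ^+ j)`_m.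
  move=> mN; apply/eqP; rewrite addrC -subr_eq; apply/eqP.
  transitivity (((1 - 'X) * T ^+ j.+1)`_m.+1).
    by rewrite mulrBl mul1r coefB coefXM.
  (* The term ['X^(N.+1)] left by truncating the series does not reach degree [m.+1 <= N]. *)
  rewrite exprS mulrA sum_powX_mulBX mulrBl coefB coefXM coefXnM /= ltnS mN.
  by rewrite subr0.
have T0 : T`_0 = 0.
  by rewrite /T coef_sum big1// => m _; rewrite coefXn.
elim: n i nN => [|n IH] i nN.
  rewrite rec// bin0n; case: i => [|i]; first by rewrite expr1 T0 add0r coef1.
  by rewrite -!horner_coef0 !hornerE horner_coef0 T0 !expr0n addr0.
rewrite rec// IH 1?ltnW//; case: i => [|i].
  by rewrite expr0 coef1 !bin0 addr0.
by rewrite IH 1?ltnW// binS natrD.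
Qed.

(** For [n >= 1], the number of lattice points of norm [n]: choose the [i] nonzero coordinates,
    their signs, and a composition of [n] into [i] positive parts. *)
Definition sphere_card (d n : nat) : R :=
  \sum_(1 <= i < d.+1) 2 ^+ i * 'C(d, i)%:R * 'C(n.-1, i.-1)%:R.

Lemma coef_ball_gf (N d n : nat) : (n < N)%N ->
  ((1 + 2%:R * (\sum_(m < N) 'X^(m.+1)) : {poly R}) ^+ d)`_n.+1 = sphere_card d n.+1.
Proof.
move=> nN; rewrite exprDn /sphere_card big_add1 -(big_mkord xpredT
  (fun i => 1 ^+ (d - i) * (2%:R * (\sum_(m < N) 'X^(m.+1))) ^+ i *+ 'C(d, i) : {poly R})).
rewrite big_nat_recl// bin0 mulr1n subn0 expr1n expr0 mulr1 coefD coef1 add0r.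
rewrite coef_sum; apply: eq_bigr => i _.
rewrite expr1n mul1r coefMn exprMn -polyC_natr -rmorphXn coefCM coef_exp_sum_powX//.
by rewrite -[LHS]mulr_natr mulrAC.
Qed.

(** The generating function of one coordinate: the value 0 and two mirror halves. *)
Lemma sum_powX_dist (N : nat) :
  \sum_(k < N + N.+1) 'X^(`|(k : nat)%:Z - N%:Z|%N) =
  1 + 2%:R * (\sum_(m < N) 'X^(m.+1)) :> {poly R}.
Proof.
rewrite big_split_ord /= big_ord_recl /=.
rewrite (_ : `|(N + 0)%N%:Z - N%:Z|%N = 0%N); last by lia.
rewrite expr0 addrCA; congr (1 + _).
rewrite mulr_natl mulr2n; congr (_ + _).
  rewrite (reindex_inj rev_ord_inj) /=; apply: eq_bigr => m _; congr ('X^_).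
  by have := ltn_ord m; lia.
by apply: eq_bigr => m _; congr ('X^_); rewrite /bump /=; lia.
Qed.

(** Distributivity over coordinates. The predicates [P i] let one formula serve both the sphere and
    its sections by coordinate hyperplanes. *)
Lemma gf_box (N d : nat) (P : 'I_d -> pred int) :
  \sum_(x <- box d N) (\prod_i (P i (x i))%:R) * 'X^(l1norm x) =
  \prod_(i < d) \sum_(k < N + N.+1)
     (P i ((k : nat)%:Z - N%:Z))%:R * 'X^(`|(k : nat)%:Z - N%:Z|%N) :> {poly R}.
Proof.
rewrite bigA_distr_bigA big_map big_enum /=; apply: eq_bigr => f _.
rewrite big_split /=; congr (_ * _).
  by apply: eq_bigr => i _; rewrite ffunE.
rewrite /l1norm expr_sum; by apply: eq_bigr => i _; rewrite ffunE.
Qed.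

Lemma sphere_sum_coef (d n : nat) (P : 'I_d -> pred int) :
  \sum_(x <- sphere d n) (\prod_i (P i (x i))%:R) =
  (\prod_(i < d) \sum_(k < n + n.+1)
     (P i ((k : nat)%:Z - n%:Z))%:R * 'X^(`|(k : nat)%:Z - n%:Z|%N) : {poly R})`_n.
Proof.
rewrite -gf_box coef_sum big_filter big_mkcond /=; apply: eq_bigr => x _.
rewrite (_ : \prod_i (P i (x i))%:R = (\prod_i (P i (x i))%:R : R)%:P); last first.
  by rewrite rmorph_prod; apply: eq_bigr => i _; rewrite /= rmorph_nat.
by rewrite coefCM coefXn eq_sym; case: eqP; rewrite ?mulr1 ?mulr0.
Qed.

Lemma size_sphere (d n : nat) : (size (sphere d n.+1))%:R = sphere_card d n.+1.
Proof.
have := @sphere_sum_coef d n.+1 (fun _ _ => true).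
rewrite -(@coef_ball_gf n.+1)// => E.
transitivity (\sum_(x <- sphere d n.+1) \prod_(i < d) (true%:R : R)).
  under eq_bigr do rewrite big1//.
  by rewrite big_const_seq count_predT iter_addr_0.
rewrite E; congr (_ `_ _); under eq_bigr do under eq_bigr do rewrite mul1r.
by rewrite sum_powX_dist big_const_ord iter_mulr_1.
Qed.

(** The pinned coordinate contributes the factor 1 to the generating function, leaving that of
    dimension [d.-1]. *)
Lemma sphere_count_coord0 (d n : nat) (i : 'I_d) :
  \sum_(x <- sphere d n.+1) (x i == 0)%:R = sphere_card d.-1 n.+1.
Proof.
have := @sphere_sum_coef d n.+1 (fun j v => (j != i) || (v == 0)).
rewrite -(@coef_ball_gf n.+1)// => E.
transitivity (\sum_(x <- sphere d n.+1)
    \prod_(j < d) ((j != i) || (x j == 0))%:R : R).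
  apply: eq_bigr => x _; rewrite (bigD1 i)//= eqxx big1 ?mulr1// => j ->.
  by [].
rewrite E; congr (_ `_ _); rewrite (bigD1 i)//= eqxx /=.
(* [rshift n.+1 ord0] is the index encoding the coordinate value 0. *)
rewrite (bigD1 (rshift n.+1 ord0))//= big1 => [|k kn].
  rewrite (_ : (n.+1 + 0)%N%:Z - n.+1%:Z = 0); last by lia.
  rewrite eqxx addr0 mul1r expr0 mul1r.
  rewrite (eq_bigr (fun=> 1 + 2%:R * \sum_(m < n.+1) 'X^(m.+1))).
    by rewrite prodr_const cardC1 card_ord.
  move=> j ji; rewrite -sum_powX_dist; apply: eq_bigr => k _.
  by rewrite ji mul1r.
case: eqP; last by rewrite mul0r.
move=> k0; exfalso; move/eqP: kn; apply; apply: val_inj => /=; lia.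
Qed.

Lemma sphere_card_gt0 (d n : nat) : (0 < d)%N -> 0 < sphere_card d n.
Proof.
move=> d0; rewrite /sphere_card big_ltn//; apply: ltr_pwDl.
  by rewrite bin0 bin1 mulr1 mulr_gt0// ltr0n.
by apply: sumr_ge0 => i _; rewrite !mulr_ge0// exprn_ge0.
Qed.

(** The absorption identity for [(d - i) * 'C(d, i)] gives [mu = d (s - s')] and
    [lambda = d (s + s')], with sum [2 d s]. *)
Lemma sphere_card_rate (d n : nat) : (0 < d)%N ->
  (sphere_card d n + sphere_card d.-1 n) / 2 / sphere_card d n =
  lambda_bd n 2 d / (lambda_bd n 2 d + mu_bd n 2 d).
Proof.
move=> d0; set s := sphere_card d n; set s' := sphere_card d.-1 n.
have s0 : 0 < s by exact: sphere_card_gt0.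
have sumE : \sum_(1 <= i < d) (d - i)%:R * 2 ^+ i * 'C(d, i)%:R * 'C(n.-1, i.-1)%:R
    = d%:R * s' :> R.
  rewrite /s' /sphere_card prednK// mulr_sumr; apply: eq_bigr => i _.
  have := mul_bin_down d i => /(congr1 (fun k : nat => k%:R : R)).
  rewrite !natrM => H; transitivity
    (2 ^+ i * ((d - i)%:R * 'C(d, i)%:R) * 'C(n.-1, i.-1)%:R : R); first by ring.
  by rewrite -H; ring.
have muE : mu_bd n 2 d = d%:R * (s - s') :> R.
  (* The factor [i] is read as [d - (d - i)]; the top term [i = d] occurs only in [s]. *)
  rewrite mulrBr -sumE /s /mu_bd /sphere_card !(big_nat_recr d)//= mulrDr mulr_sumr.
  rewrite addrAC -sumrB; congr (_ + _); last by ring.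
  rewrite big_nat_cond [RHS]big_nat_cond; apply: eq_bigr => i /andP[/andP[_ id] _].
  by rewrite natrB ?(ltnW id)//; ring.
have -> : lambda_bd n 2 d = d%:R * (s + s') :> R.
  by rewrite /lambda_bd muE sumE; ring.
rewrite muE; have d1 : d%:R != 0 :> R by rewrite pnatr_eq0 -lt0n.
rewrite (_ : _ + d%:R * (s - s') = 2 * d%:R * s); last by ring.
by field; rewrite d1 gt_eqF.
Qed.

End SphereCount.

(** * The random walk and its active times *)

(** The disjoint events [F i] cover almost surely: their masses add up to one, so the complement of
    the union is null. *)
Lemma probability_total (R : realType) (dT : measure_display)
    (T : measurableType dT) (P : probability T R) (I : finType) (F : I -> set T)
    (D : set T) :
  (forall i, measurable (F i)) -> trivIset setT F -> (\sum_i P (F i) = 1)%E ->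
  measurable D -> (P D = \sum_i P (F i `&` D))%E.
Proof.
move=> mF tF F1 mD.
have sumE (G : I -> set T) : (forall i, measurable (G i)) -> trivIset setT G ->
    P (\bigcup_i G i) = (\sum_i P (G i))%E.
  move=> mG tG; rewrite measure_fin_bigcup//; last exact: finite_finset.
  rewrite (_ : [set: I] = [set` enum I]).
    by rewrite -fsbig_seq ?enum_uniq// big_enum.
  by apply/seteqP; split => // i _ /=; rewrite mem_enum.
have mU : measurable (\bigcup_i F i) by apply: fin_bigcup_measurable.
rewrite -sumE; last 2 first.
- by move=> i; exact: measurableI.
- exact: trivIset_setIr.
rewrite -setI_bigcupl.
rewrite -[in LHS](setIT D) -(setUv (\bigcup_i F i)) setIUr measureU0 1?setIC//.
- exact: measurableI.
- by apply: measurableI => //; exact: measurableC.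
- apply/eqP; rewrite eq_le measure_ge0 andbT.
  have <- : P (~` (\bigcup_i F i)) = 0%E.
    by rewrite probability_setC// sumE// F1 subee.
  apply: le_measure; rewrite ?inE//.
  + by apply: measurableI => //; exact: measurableC.
  + exact: measurableC.
Qed.

(** * Measurability, cylinders of increments, and the law of the norm at active times *)

Section WalkModel.
Variables (R : realType) (d : nat) (a : 'I_d -> R).
Hypothesis a_gt0 : forall i, 0 < a i.
Hypothesis a_sum : 2 * \sum_i a i = 1.
Variables (dT : measure_display) (T : measurableType dT) (P : probability T R).
Variable e : nat -> T -> 'I_d -> int.
Hypothesis model : walk_model P a e.
Local Notation V := {ffun 'I_d -> int}.
Local Notation Avg := (avg a (@step d)).

Lemma walkS k w : walk e k.+1 w = (fun i => walk e k w i + e k.+1 w i).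
Proof. by apply/funext => i; rewrite /walk big_nat_recr. Qed.

Lemma measurable_increment s v : measurable [set w | e s w = v].
Proof. by case: model. Qed.

Lemma measurable_exists (U : countType) (A : U -> set T) :
  (forall u, measurable (A u)) -> measurable [set w | exists u, A u w].
Proof.
move=> mA; rewrite (_ : [set w | _] = \bigcup_u A u).
  exact: countable_bigcupT_measurable.
by apply/seteqP; split => w [u]; exists u.
Qed.

Lemma measurable_forall (U : countType) (A : U -> set T) :
  (forall u, measurable (A u)) -> measurable [set w | forall u, A u w].
Proof.
move=> mA; rewrite (_ : [set w | _] = ~` [set w | exists u, (~` A u) w]).
  by apply/measurableC/measurable_exists => u; exact: measurableC.
apply/seteqP; split => [w Aw [u]|w nA u]; first exact.
by apply: contrapT => Au; apply: nA; exists u.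
Qed.

Lemma measurable_prop (Q : Prop) : measurable [set _ : T | Q].
Proof.
have [q|q] := pselect Q.
  by rewrite (_ : [set _ | _] = setT)//; apply/seteqP; split.
by rewrite (_ : [set _ | _] = set0)//; apply/seteqP; split.
Qed.

Lemma measurable_walk k (v : V) : measurable [set w | walk e k w = v].
Proof.
elim: k v => [|k IH] v.
  rewrite (_ : [set w | _] = [set _ | (fun=> 0) = v :> ('I_d -> int)]).
    exact: measurable_prop.
  suff W w : walk e 0 w = (fun=> 0) by apply/seteqP; split => w /=; rewrite W.
  by apply/funext => i; rewrite /walk big_nil.
rewrite (_ : [set w | _] =
    [set w | exists u : V, ([set w | walk e k w = u] `&`
                            [set w | e k.+1 w = (v - u : V)]) w]).
  apply: measurable_exists => u; apply: measurableI; first exact: IH.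
  exact: measurable_increment.
apply/seteqP; split => w /=.
  rewrite walkS => vE; exists [ffun i => walk e k w i]; split.
    by apply/funext => i; rewrite ffunE.
  by apply/funext => i; rewrite !ffunE -vE addrC addKr.
move=> [u [wE eE]]; rewrite walkS wE eE; apply/funext => i.
by rewrite !ffunE addrC subrK.
Qed.

Lemma measurable_l1norm k (Q : nat -> Prop) :
  measurable [set w | Q (l1norm (walk e k w))].
Proof.
rewrite (_ : [set w | _] =
    [set w | exists u : V, ([set w | walk e k w = u] `&` [set _ | Q (l1norm u)]) w]).
  apply: measurable_exists => u; apply: measurableI; first exact: measurable_walk.
  exact: measurable_prop.
apply/seteqP; split => w /=; last by move=> [u [-> ]].
move=> Qw; exists [ffun i => walk e k w i].
suff E : walk e k w = [ffun i => walk e k w i] by rewrite -E.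
by apply/funext => i; rewrite ffunE.
Qed.

Lemma measurable_l1norm_eq k k' :
  measurable [set w | l1norm (walk e k w) = l1norm (walk e k' w)].
Proof.
rewrite (_ : [set w | _] = [set w | exists n, ([set w | l1norm (walk e k w) = n]
    `&` [set w | l1norm (walk e k' w) = n]) w]).
  apply: measurable_exists => n; apply: measurableI.
    exact: (measurable_l1norm k (fun l => l = n)).
  exact: (measurable_l1norm k' (fun l => l = n)).
by apply/seteqP; split => w /=; [move=> ->; eexists|move=> [n [-> ->]]].
Qed.

Lemma measurable_active_at j k : measurable [set w | active_at e j w k].
Proof.
elim: j k => [|j IH] k /=; first exact: measurable_prop.
apply: (measurable_exists (A := fun k' => [set w | active_at e j w k' /\ (k' < k)%N /\
      l1norm (walk e k w) <> l1norm (walk e k' w) /\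
      (forall m, (k' < m < k)%N -> l1norm (walk e m w) = l1norm (walk e k' w))])) => k'.
apply: measurableI; first exact: IH.
apply: measurableI; first exact: measurable_prop.
apply: measurableI; first exact/measurableC/measurable_l1norm_eq.
apply: (measurable_forall (A := fun m => [set w | (k' < m < k)%N ->
  l1norm (walk e m w) = l1norm (walk e k' w)])) => m.
case: (k' < m < k)%N.
  rewrite (_ : [set w | _] = [set w | l1norm (walk e m w) = l1norm (walk e k' w)]).
    exact: measurable_l1norm_eq.
  by apply/seteqP; split => w /=; [exact|].
by rewrite (_ : [set w | _] = setT)//; apply/seteqP; split.
Qed.

Lemma measurable_norm_at_active j n : measurable (norm_at_active e j n).
Proof.
apply: (measurable_exists (A := fun k => [set w | active_at e j w k /\
  l1norm (walk e k w) = n])) => k.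
apply: measurableI; first exact: measurable_active_at.
exact: (measurable_l1norm k (fun l => l = n)).
Qed.

Definition signed_step (s : 'I_d * bool) : V := if s.2 then step s.1 else - step s.1.

Lemma signed_step_inj : injective signed_step.
Proof.
move=> [i b] [j c] /ffunP/(_ i); rewrite /signed_step /=.
by case: b; case: c; rewrite !ffunE /unitv eqxx; case: eqP => [->|]//=; lia.
Qed.

Lemma prob_signed_step t s : (0 < t)%N ->
  P [set w | e t w = signed_step s] = (a s.1)%:E.
Proof.
move=> t0; have [_ /(_ t s.1 t0)[Pp Pm] _] := model; rewrite /signed_step.
have E : step s.1 = unitv s.1 :> ('I_d -> int) by apply/funext => i; rewrite ffunE.
case: s.2; first by rewrite E.
rewrite (_ : - step s.1 = (fun k => - unitv s.1 k) :> ('I_d -> int))//.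
by apply/funext => i; rewrite !ffunE.
Qed.

(** Prescribes the increments at times 1 to [k]; the list form matches the independence clause of
    [walk_model]. *)
Definition cylinder k (c : nat -> 'I_d * bool) : set T :=
  [set w | forall t, t \in index_iota 1 k.+1 -> e t w = signed_step (c t)].

Definition endpoint k (c : nat -> 'I_d * bool) : V :=
  \sum_(1 <= t < k.+1) signed_step (c t).

Definition weight k (c : nat -> 'I_d * bool) : R := \prod_(1 <= t < k.+1) a (c t).1.

Lemma prob_cylinder k c : P (cylinder k c) = (weight k c)%:E.
Proof.
have [_ _ indep] := model.
rewrite /cylinder (indep _ (fun t => signed_step (c t) : 'I_d -> int)) ?iota_uniq//.
  rewrite /weight -prodEFin; apply: eq_big_seq => t.
  by rewrite mem_index_iota => /andP[t0 _]; rewrite prob_signed_step.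
by apply/allP => t; rewrite mem_index_iota => /andP[].
Qed.

Lemma measurable_cylinder k c : measurable (cylinder k c).
Proof.
apply: (measurable_forall (A := fun t => [set w | t \in index_iota 1 k.+1 ->
  e t w = signed_step (c t)])) => t.
case: (t \in _).
  rewrite (_ : [set w | _] = [set w | e t w = signed_step (c t)]).
    exact: measurable_increment.
  by apply/seteqP; split => w /=; [exact|].
by rewrite (_ : [set w | _] = setT)//; apply/seteqP; split.
Qed.

Lemma walk_cylinder k c t w : cylinder k c w -> (t <= k)%N -> walk e t w = endpoint t c.
Proof.
move=> cw tk; apply/funext => i; rewrite /walk /endpoint sum_ffunE big_seq [RHS]big_seq.
apply: eq_bigr => s; rewrite mem_index_iota => /andP[s0 st].
by rewrite cw// mem_index_iota s0 (leq_trans st).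
Qed.

Lemma endpointS k c : endpoint k.+1 c = endpoint k c + signed_step (c k.+1).
Proof. by rewrite /endpoint big_nat_recr. Qed.

Lemma l1norm_endpointS k c : l1norm (endpoint k.+1 c) <> l1norm (endpoint k c).
Proof.
rewrite endpointS /signed_step; case: (c k.+1) => i [] /= /(congr1 odd).
  by rewrite odd_l1norm_stepD; case: odd.
by rewrite odd_l1norm_stepB; case: odd.
Qed.

(** On a cylinder each step changes the parity of the norm, so no instant is skipped. *)
Lemma active_at_cylinder j c w k : cylinder j c w -> active_at e j w k <-> k = j.
Proof.
move=> cw; suff : forall i, (i <= j)%N -> forall k, active_at e i w k <-> k = i by exact.
elim=> // i IH ij k1 /=.
have neq : l1norm (walk e i.+1 w) <> l1norm (walk e i w).
  by rewrite !(walk_cylinder cw)// 1?ltnW//; exact: l1norm_endpointS.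
split=> [[k' [/(IH (ltnW ij)) -> [ik [_ between]]]]|->].
  apply/eqP; rewrite eq_sym eqn_leq ik leqNgt; apply/negP => ik1.
  by apply: neq; apply: between; rewrite ltnSn.
by exists i; split; [exact/(IH (ltnW ij))|split => //; split => // m; lia].
Qed.

Lemma cylinder_norm_at_active j c n :
  cylinder j c `&` norm_at_active e j n =
  if l1norm (endpoint j c) == n then cylinder j c else set0.
Proof.
apply/seteqP; split => [w [cw [k [/(active_at_cylinder _ cw) -> <-]]]|w].
  by rewrite (walk_cylinder cw)// eqxx.
case: eqP => // en cw; split=> //; exists j; split; first exact/(active_at_cylinder _ cw).
by rewrite (walk_cylinder cw).
Qed.

Definition extend k (c : nat -> 'I_d * bool) s : nat -> 'I_d * bool :=
  fun t => if t == k.+1 then s else c t.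

Lemma weight_extend k c s : weight k.+1 (extend k c s) = weight k c * a s.1.
Proof.
rewrite /weight big_nat_recr//= /extend eqxx; congr (_ * _).
rewrite big_nat [RHS]big_nat; apply: eq_bigr => t /andP[_ tk].
by rewrite ltn_eqF.
Qed.

Lemma endpoint_extend k c s : endpoint k.+1 (extend k c s) = endpoint k c + signed_step s.
Proof.
rewrite endpointS /extend eqxx; congr (_ + _).
rewrite /endpoint big_nat [RHS]big_nat; apply: eq_bigr => t /andP[_ tk].
by rewrite ltn_eqF.
Qed.

Lemma cylinder_extend k c s :
  cylinder k.+1 (extend k c s) = [set w | e k.+1 w = signed_step s] `&` cylinder k c.
Proof.
apply/seteqP; split => w.
  move=> cw; split.
    by have := cw k.+1; rewrite mem_index_iota /extend eqxx ltnS leqnn; apply.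
  move=> t; rewrite mem_index_iota => /andP[t0 tk].
  by have := cw t; rewrite mem_index_iota t0 ltnS (ltnW tk) /extend ltn_eqF//; apply.
move=> [/= ew cw] t; rewrite mem_index_iota => /andP[t0]; rewrite ltnS leq_eqVlt /extend.
by case: eqP => [->|_]//= tk; apply: cw; rewrite mem_index_iota t0.
Qed.

Lemma sum_steps (f : 'I_d * bool -> R) :
  \sum_s f s = \sum_i (f (i, true) + f (i, false)).
Proof.
rewrite (eq_bigr (fun s => f (s.1, s.2))); last by case.
rewrite -(pair_bigA _ (fun i b => f (i, b))) /=.
by apply: eq_bigr => i _; rewrite big_bool.
Qed.

(** Splits on the next increment, whose signed unit values have total mass [2 * \sum_i a i = 1]. *)
Lemma prob_cylinder_total k c (D : set T) : measurable D ->
  (P (cylinder k c `&` D) = \sum_s P (cylinder k.+1 (extend k c s) `&` D))%E.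
Proof.
move=> mD; rewrite (probability_total (F := fun s => [set w | e k.+1 w = signed_step s])).
- by apply: eq_bigr => s _; rewrite cylinder_extend setIA.
- by move=> s; exact: measurable_increment.
- apply/trivIsetP => s s' _ _ ss'; apply/seteqP; split => // w [/= -> E].
  by move/eqP: ss'; apply; apply: signed_step_inj; apply/ffunP => i; rewrite E.
- under eq_bigr do rewrite prob_signed_step//.
  rewrite sumEFin sum_steps -a_sum mulr_sumr; congr EFin.
  by apply: eq_bigr => i _; rewrite mulr_natl mulr2n.
- by apply: measurableI => //; exact: measurable_cylinder.
Qed.

(* Backward induction on the length of the prescribed prefix. *)
Lemma prob_cylinderI j (D : set T) (g : V -> R) : measurable D ->
  (forall c, P (cylinder j c `&` D) = (weight j c * g (endpoint j c))%:E) ->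
  forall m k, (k + m)%N = j -> forall c,
  P (cylinder k c `&` D) = (weight k c * iter m Avg g (endpoint k c))%:E.
Proof.
move=> mD Pj; elim=> [|m IH] k km c; first by rewrite -(addn0 k) km.
rewrite prob_cylinder_total//; under eq_bigr do rewrite IH ?addSnnS//.
rewrite sumEFin sum_steps iter_avgS mulr_sumr; congr EFin; apply: eq_bigr => i _.
by rewrite !weight_extend !endpoint_extend /signed_step /=; ring.
Qed.

(** The empty prefix: [cylinder 0 c0] is the whole space, of weight one and endpoint 0. *)
Lemma prob_walk j (D : set T) (g : V -> R) (c0 : nat -> 'I_d * bool) : measurable D ->
  (forall c, P (cylinder j c `&` D) = (weight j c * g (endpoint j c))%:E) ->
  P D = (iter j Avg g 0)%:E.
Proof.
move=> mD Pj; have := prob_cylinderI mD Pj (add0n j) c0.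
rewrite /weight /endpoint !big_nil mul1r => <-; congr (P _).
by apply/seteqP; split => // w Dw; split.
Qed.

Lemma prob_cylinder_norm j n c :
  P (cylinder j c `&` norm_at_active e j n) =
  (weight j c * (l1norm (endpoint j c) == n)%:R)%:E.
Proof.
rewrite cylinder_norm_at_active; case: eqP => _.
  by rewrite prob_cylinder mulr1.
by rewrite measure0 mulr0.
Qed.

Lemma prob_norm_at_active j n (i0 : 'I_d) :
  P (norm_at_active e j n) = (iter j Avg (fun z => (l1norm z == n)%:R) 0)%:E.
Proof.
apply: (prob_walk (fun=> (i0, true))); first exact: measurable_norm_at_active.
exact: prob_cylinder_norm.
Qed.

(** Once [j] increments are fixed with endpoint on the sphere, a single further averaging of the
    indicator of norm [n.+1] yields [up_rate]. *)
Lemma prob_norm_at_active_succ j n (i0 : 'I_d) :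
  P (norm_at_active e j.+1 n.+1 `&` norm_at_active e j n) =
  (iter j Avg (fun z => (l1norm z == n)%:R * up_rate a z) 0)%:E.
Proof.
apply: (prob_walk (fun=> (i0, true))).
  by apply: measurableI; exact: measurable_norm_at_active.
move=> c; rewrite [_ `&` norm_at_active e j n]setIC setIA cylinder_norm_at_active.
case: eqP => [en|_]; last by rewrite set0I measure0 mul0r mulr0.
apply: etrans (prob_cylinderI (measurable_norm_at_active j.+1 n.+1)
  (prob_cylinder_norm j.+1 n.+1) (addn1 j) c) _ => /=.
by rewrite mul1r -avg_norm_succ en.
Qed.

End WalkModel.

(** * The limiting upward probability and its independence of the weights *)

Section UpProbability.
Variables (R : realType) (d : nat) (a : 'I_d -> R).
Hypothesis a_gt0 : forall i, 0 < a i.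
Hypothesis a_sum : 2 * \sum_i a i = 1.
Hypothesis d_gt0 : (0 < d)%N.
Local Notation V := {ffun 'I_d -> int}.
Local Notation Avg := (avg a (@step d)).
Local Notation Hit := (hit a (@step d)).

(** At the origin every step goes outward, hence the value 1; the closed formula is for [n >= 1]. *)
Definition up_prob (n : nat) : R :=
  if n is 0 then 1 else lambda_bd n 2 d / (lambda_bd n 2 d + mu_bd n 2 d).

Lemma size_sphere_gt0 n : 0 < (size (sphere d n))%:R :> R.
Proof.
have [x xn] := exists_norm n (Ordinal d_gt0).
have : x \in sphere d n by rewrite mem_sphere xn.
by rewrite ltr0n; case: (sphere d n).
Qed.

(** Here the weights disappear: the number of points of the sphere with [x i = 0] is the same for
    all [i], so only [\sum_i a i = 1 / 2] enters. *)
Lemma mean_up_rate n :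
  (\sum_(x <- sphere d n) up_rate a x) / (size (sphere d n))%:R = up_prob n.
Proof.
case: n => [|n].
  rewrite (eq_big_seq (fun=> 1)) => [|x].
    by rewrite big_const_seq count_predT iter_addr_0 divff// gt_eqF// size_sphere_gt0.
  rewrite mem_sphere => /eqP/l1norm_eq0 ->; rewrite /up_rate -[RHS]a_sum mulr_sumr.
  by apply: eq_bigr => i _; rewrite ffunE eqxx mulrC.
rewrite /up_prob -sphere_card_rate// -size_sphere; congr (_ / _).
rewrite exchange_big /= (eq_bigr (fun i => a i *
    ((size (sphere d n.+1))%:R + sphere_card R d.-1 n.+1))).
  by rewrite -mulr_suml mulrC; congr (_ * _); have := a_sum; lra.
move=> i _; rewrite -mulr_sumr big_split /= sphere_count_coord0.
by rewrite big_const_seq count_predT iter_addr_0.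
Qed.

Lemma return_gt0 k : 0 < Hit (k + k) 0.
Proof.
apply: (hit_return_gt0 a_gt0 a_sum (@box_uniq d) (box0 d) _ (@size_box d)).
by move=> j i x; exact: boxS.
Qed.

Lemma sphere_mass_cvg n :
  (fun k => iter (odd n + (k + k)) Avg (fun z => (l1norm z == n)%:R) 0 /
            Hit (k + k) 0) @ \oo --> ((size (sphere d n))%:R : R).
Proof.
have := @iter_avg_sphere_cvg R d a a_gt0 a_sum n (fun=> 1).
rewrite big_const_seq count_predT iter_addr_0.
by under eq_fun => k do under [X in iter _ _ X _]eq_fun do rewrite mulr1.
Qed.

(** Numerator and denominator are both divided by the return probability; the denominator then has a
    positive limit, the size of the sphere. *)
Lemma up_prob_cvg n :
  (fun k => iter (odd n + (k + k)) Avg (fun z => (l1norm z == n)%:R * up_rate a z) 0 /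
            iter (odd n + (k + k)) Avg (fun z => (l1norm z == n)%:R) 0)
    @ \oo --> up_prob n.
Proof.
rewrite -mean_up_rate.
rewrite (_ : (fun k => _) = (fun k =>
  (iter (odd n + (k + k)) Avg (fun z => (l1norm z == n)%:R * up_rate a z) 0 /
     Hit (k + k) 0) *
  (iter (odd n + (k + k)) Avg (fun z => (l1norm z == n)%:R) 0 / Hit (k + k) 0)^-1)).
  apply: cvgM; first exact: iter_avg_sphere_cvg.
  by apply: cvgV; [rewrite gt_eqF// size_sphere_gt0|exact: sphere_mass_cvg].
apply/funext => k; rewrite invf_div mulrA divfK//.
by rewrite gt_eqF// return_gt0.
Qed.

End UpProbability.

Theorem theorem2p1 (R : realType) (d : nat) (hd : (2 <= d)%N) :
  exists p : nat -> R,
    (forall n : nat, (1 <= n)%N ->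
       p n = lambda_bd n 2 d / (lambda_bd n 2 d + mu_bd n 2 d)) /\
    (forall a : 'I_d -> R, (forall i, 0 < a i) -> 2 * \sum_(i < d) a i = 1 ->
     forall (dT : measure_display) (T : measurableType dT)
            (P : probability T R) (e : nat -> T -> 'I_d -> int),
       walk_model P a e ->
       forall n : nat,
         cond_limit P (fun j => norm_at_active e j n)
                      (fun j => trans_prob P e n j) (p n)).
Proof.
exists (up_prob R d); split; first by case.
move=> a a_gt0 a_sum dT T P e model n.
have d_gt0 : (0 < d)%N by exact: ltnW.
have P_norm j := prob_norm_at_active a_sum model j n (Ordinal d_gt0).
have P_succ j := prob_norm_at_active_succ a_sum model j n (Ordinal d_gt0).
have odd_n k : odd (odd n + (k + k)) = odd n by rewrite oddD addnn odd_double oddb addbF.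
split=> [J|eps eps0].
  have := cvgr_gt _ (@sphere_mass_cvg R d a a_gt0 a_sum n) _ (size_sphere_gt0 R d_gt0 n).
  (* This index has the parity of [n] and is late enough for the rescaled mass of the sphere to be
     positive. *)
  case=> K _ HK; exists (odd n + (maxn J K + maxn J K))%N; split; first by lia.
  have := HK (maxn J K) (leq_maxr _ _).
  by rewrite /= pmulr_lgt0 ?invr_gt0 ?return_gt0// P_norm lte_fin.
have /cvgrPdist_lt/(_ _ eps0)[K _ HK] := @up_prob_cvg R d a a_gt0 a_sum d_gt0 n.
(* This bound guarantees [K <= j./2], the index at which the limit is used. *)
exists (K + K).+1 => j Kj; rewrite P_norm lte_fin => den0.
(* Positivity of the conditioning event excludes the times of the wrong parity. *)
have jn : odd j = odd n.
  apply: contraTeq den0 => jn; rewrite iter_avg_parity ?ltxx// => z.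
  rewrite l1norm0 add0n; case: eqP => // ->.
  by move=> E; rewrite E eqxx in jn.
have jE : j = (odd n + (j./2 + j./2))%N by rewrite -jn addnn odd_double_half.
rewrite /trans_prob P_norm P_succ /= distrC jE; apply: HK => /=; lia.
Qed.
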